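(* (In ZFC.) Let $X$ be a Polish space and let $\mathcal{KD}$ be the monoid of set operators on $X$ generated by $k$ (closure), $c$ (complement) and $d$ (points of second category). Then the cardinality of $\mathcal{KD}$ is $\leq 22$. Moreover, if $X=\mathbb{R}$ with the usual topology, then there exists a set $A\subseteq\mathbb{R}$ for which $\#\{oA : o\in\mathcal{KD}\}=22$.
   Context: The base theory is ZFC. A Polish space is a separable completely metrizable topological space. A set operator on $X$ is a map from the power set of $X$ to itself; operators are multiplied by composition, and $oA$ denotes the value of $o$ at $A\subseteq X$. For $A\subseteq X$: $kA$ is the topological closure of $A$; $cA=X\setminus A$; and $dA$ is the set of all points of second category for $A$, i.e. $dA=\{p\in X : \text{for every open neighborhood } U \text{ of } p,\ U\cap A \text{ is nonmeager in } X\}$. $\mathcal{KD}$ is the monoid (under composition, containing the identity operator) of set operators on $X$ generated by $k$, $c$ and $d$. *)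

(* Defs.v *)
From mathcomp Require Import all_boot all_order all_algebra.
From mathcomp Require Import boolp classical_sets functions cardinality reals.
From mathcomp Require Import topology normedtype.

Set Implicit Arguments.
Unset Strict Implicit.
Unset Printing Implicit Defensive.

Import Order.TTheory GRing.Theory Num.Theory.
(* The usual topology on a realType. *)
Export numFieldNormedType.Exports.

Local Open Scope classical_set_scope.
Local Open Scope ring_scope.

Definition metric (R : realType) (X : Type) (d : X -> X -> R) : Prop :=
  [/\ forall x y, 0 <= d x y,
      forall x y, d x y = 0 <-> x = y,
      forall x y, d x y = d y x &
      forall x y z, d x z <= d x y + d y z].

Definition induces_topology (R : realType) (X : topologicalType)
    (d : X -> X -> R) : Prop :=
  forall x : X,
    nbhs x = filter_from [set e : R | 0 < e] (fun e => [set y | d x y < e]).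

(* Convergence is that of the given topology of X; for a metric satisfying
   [induces_topology] it is convergence with respect to d. *)
Definition complete_metric (R : realType) (X : topologicalType)
    (d : X -> X -> R) : Prop :=
  forall u : nat -> X,
    (forall e : R, 0 < e -> exists N : nat,
      forall m n : nat, (N <= m)%N -> (N <= n)%N -> d (u m) (u n) < e) ->
    exists l : X, u @ \oo --> l.

Definition completely_metrizable (R : realType) (X : topologicalType) : Prop :=
  exists d : X -> X -> R,
    [/\ metric d, induces_topology d & complete_metric d].

Definition separable (X : topologicalType) : Prop :=
  exists2 D : set X, countable D & dense D.

Definition polish (R : realType) (X : topologicalType) : Prop :=
  separable X /\ completely_metrizable R X.

Definition nowhere_dense (X : topologicalType) (A : set X) : Prop :=
  interior (closure A) = set0.

Definition meager (X : topologicalType) (A : set X) : Prop :=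
  exists2 F : nat -> set X,
    (forall n, nowhere_dense (F n)) & A = \bigcup_n F n.

Definition second_category_points (X : topologicalType) (A : set X) : set X :=
  [set p | forall U : set X, open_nbhs p U -> ~ meager (U `&` A)].

(* Set operators are compared by Leibniz equality, which by functional and
   propositional extensionality is equality of values on all subsets of X. *)
Definition submonoid (X : Type) (M : set (set X -> set X)) : Prop :=
  M id /\ forall o1 o2, M o1 -> M o2 -> M (o1 \o o2).

Definition KD (X : topologicalType) : set (set X -> set X) :=
  smallest (@submonoid X)
    [set @closure X; @setC X; @second_category_points X].
Arguments KD : clear implicits.

(* Main.v *)
Require Import Defs.
From HB Require Import structures.
From mathcomp Require Import all_boot all_order all_algebra.
From mathcomp Require Import boolp classical_sets functions cardinality reals.
From mathcomp Require Import topology normedtype.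
From mathcomp Require Import zify ring lra.

(** Write [k], [c], [d] for closure, complement and points of second category.

Upper bound.  In a second countable space a set loses only a meager part when
its localization [d A] is removed (meager_setD_second_category), so [d A] is the
closure of its interior: [kckcd = d].  In a Baire space [d U = k U] for open [U],
whence [dck = kck], and [d F] is the closure of the interior of [F] for closed [F],
whence [dk = kckck], [dd = d] and [dcd = kcd].  With [cc = 1], [kk = k], [kd = d]
and the identity [kckckck = kck] of Kuratowski, these rules reduce the product of
a letter with any of 22 reduced words to one of those words (act_mul,
reduced_wordsM).  The reduced words thus give all of the monoid (KD_reduced).

Lower bound.  All the operators are local: on an open set [U] the value at [A]
depends only on [A] inside [U] (local_act).  Hence pieces with prescribed
behaviour, placed around distinct integers, can be glued into one set, and it
suffices that the 22 words have different tables of truth values at these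
integers.  Each piece lives in a finite family of sets stable under [k], [c] and
[d], so that the tables are found by computation (uniq_signature).  One family
consists of the unions of the half-lines and the point cut out by a real number.
The other is made of three dense sets: a countable one, and the rests of a set
[V] and of its complement, both everywhere of second category.  Such a [V] is
needed to tell [d] from [kcdc], which agree on sets with the Baire property.  It
is built as Vitali's set is: the triadic rationals [T] are the disjoint union of
[2T] and [2T + 1], so that choosing a representative [r] in every coset of [T] and
taking for [V] the union of the [r + 2T] makes the complement of [V] a translate
of [V], while [V] is invariant under the dense group [2T]. *)

Set Implicit Arguments.
Unset Strict Implicit.
Unset Printing Implicit Defensive.

Import Order.TTheory GRing.Theory Num.Theory.

Local Open Scope classical_set_scope.
Local Open Scope card_scope.

(** * Meager sets *)

Section Meager.
Variable X : topologicalType.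
Implicit Types A B F U W : set X.

Lemma sub_nowhere_dense A B : A `<=` B -> nowhere_dense B -> nowhere_dense A.
Proof.
move=> AB; rewrite /nowhere_dense -!subset0 => nB; apply: subset_trans nB.
exact/interiorS/closureS.
Qed.

Lemma nowhere_dense0 : nowhere_dense (set0 : set X).
Proof. by rewrite /nowhere_dense closure0 interior0. Qed.

Lemma sub_meager A B : A `<=` B -> meager B -> meager A.
Proof.
move=> AB [F nF BF]; exists (fun n => F n `&` A).
  by move=> n; apply: sub_nowhere_dense (nF n); exact: subIsetl.
by rewrite -setI_bigcupl -BF setIC; exact/esym/setIidPl.
Qed.

Lemma nowhere_dense_meager A : nowhere_dense A -> meager A.
Proof. by exists (fun=> A) => //; rewrite bigcup_const. Qed.

Lemma meager_bigcup (J : choiceType) (D : set J) (F : J -> set X) :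
  countable D -> (forall i, D i -> meager (F i)) -> meager (\bigcup_(i in D) F i).
Proof.
move=> cD mF.
have /choice[G GP] : forall i, exists G : nat -> set X,
    D i -> (forall n, nowhere_dense (G n)) /\ F i = \bigcup_n G n.
  move=> i; have [Di|nDi] := pselect (D i); last by exists (fun=> set0).
  by have [G nG FG] := mF i Di; exists G.
have /countable_injP[f injf] : countable (D `*` [set: nat]).
  exact: countableX.
(* By injectivity of f, each member of this sequence is empty or one G i n. *)
exists (fun k => \bigcup_(ij in D `*` [set: nat] `&` f @^-1` [set k])
                   G ij.1 ij.2).
  move=> k; have [[[i n] [[/= Di _] fk]]|none] := pselect (exists ij,
      (D `*` [set: nat] `&` f @^-1` [set k]) ij).
    apply: sub_nowhere_dense ((GP i Di).1 n) => x [ij [Dij fij] Gx].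
    have /= := injf ij (i, n); rewrite !inE; move/(_ Dij)/(_ (conj Di I)).
    by rewrite fij fk => /(_ erefl) ijE; rewrite ijE in Gx.
  apply: sub_nowhere_dense nowhere_dense0 => x [ij Dij _].
  by apply: none; exists ij.
apply/seteqP; split=> x.
  move=> [i Di]; rewrite (GP i Di).2 => -[n _ Gx].
  by exists (f (i, n)) => //; exists (i, n).
move=> [k _ [[i n] [[/= Di _] _] Gx]]; exists i => //.
by rewrite (GP i Di).2; exists n.
Qed.

Lemma meagerU A B : meager A -> meager B -> meager (A `|` B).
Proof.
move=> mA mB; rewrite -bigcup2E; apply: meager_bigcup; first exact: countableP.
move=> -[|[|n]] _ //=.
exact: nowhere_dense_meager nowhere_dense0.
Qed.

(** The frontier of a closed set is nowhere dense; this is the form localized to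
an open set. *)
Lemma closed_nowhere_dense F U :
  closed F -> open U -> U `&` interior F = set0 -> nowhere_dense (U `&` F).
Proof.
move=> cF oU UF0; rewrite /nowhere_dense -subset0 => x Wx.
have WF : interior (closure (U `&` F)) `<=` interior F.
  rewrite [X in _ `<=` interior X]((closure_id F).1 cF); apply: interiorS.
  by apply: closureS; exact: subIsetr.
have [y [[Uy _] Wy]] := interior_subset Wx _ (nbhs_interior Wx).
have : (U `&` interior F) y by split=> //; exact: WF.
by rewrite UF0.
Qed.

End Meager.

(** * Points of second category *)

Section SecondCategory.
Variable X : topologicalType.
Implicit Types A B F U W : set X.

Local Notation d := (@second_category_points X).
Local Notation k := (@closure X).

Lemma not_second_category A p :
  ~ d A p -> exists2 U, open_nbhs p U & meager (U `&` A).
Proof.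
move=> /existsNP[U /not_implyP[pU /contrapT mU]]; by exists U.
Qed.

Lemma closed_second_category A : closed (d A).
Proof.
rewrite -openC openE => p /not_second_category[U pU mU].
rewrite /interior nbhsE; exists U => // q Uq dq.
by case: pU => oU _; apply: dq mU.
Qed.

Lemma sub_second_category A B : A `<=` B -> d A `<=` d B.
Proof.
move=> AB p dp U pU mU; apply: dp pU _; apply: sub_meager mU.
exact: setIS.
Qed.

Lemma sub_meager_second_category A B M :
  meager M -> A `<=` B `|` M -> d A `<=` d B.
Proof.
move=> mM AB p dp U pU mU; apply: dp (pU) _.
apply: sub_meager (meagerU mU mM) => x [Ux /AB[Bx|Mx]]; [by left|by right].
Qed.

Lemma second_category_sub_closure A : d A `<=` k A.
Proof.
move=> p dp W; rewrite nbhsE => -[U pU UW]; apply: contrapT => noAW.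
apply: dp pU _; apply: sub_meager (nowhere_dense_meager (nowhere_dense0 X)).
by move=> x [Ux Ax]; apply: noAW; exists x; split=> //; apply: UW.
Qed.

Lemma meager_second_category A : meager A -> d A = set0.
Proof.
move=> mA; rewrite -subset0 => p /(_ setT); apply=> //.
  by split=> //; exact: openT.
by rewrite setTI.
Qed.

(** A point of [A] outside [d A] lies in a basic open set meeting [A] in a meager
set, and there are countably many basic open sets. *)
Lemma meager_setD_second_category A : @second_countable X -> meager (A `\` d A).
Proof.
move=> [B cB [_ basB]].
have mU : forall U, (B `&` [set U | meager (U `&` A)]) U -> meager (U `&` A).
  by move=> U [].
apply: sub_meager (meager_bigcup _ mU); last first.
  by apply: sub_countable cB; apply: subset_card_le => U [].
move=> x [Ax /not_second_category[U xU mUA]].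
have [] := basB x U; first exact: open_nbhs_nbhs.
move=> V [BV Vx] VU; exists V => //; split=> //.
by apply: sub_meager mUA; exact: setSI.
Qed.

(** If an open [U] misses the interior of the closed set [d A], then [U] meets
[d A] in a nowhere dense set; as almost all of [A] lies in [d A], it meets [A] in
a meager set, so [U] contains no point of [d A]. *)
Lemma interior_second_category A : @second_countable X ->
  k (interior (d A)) = d A.
Proof.
move=> scX; apply/seteqP; split=> p.
  rewrite [X in _ -> X p]((closure_id _).1 (@closed_second_category A)).
  by apply: closureS; exact: interior_subset.
move=> dp W; rewrite nbhsE => -[U pU UW]; apply: contrapT => disj.
apply: dp (pU) _.
have ndU : nowhere_dense (U `&` d A).
  apply: closed_nowhere_dense; [exact: closed_second_category|by case: pU|].
  rewrite -subset0 => x [Ux iAx]; apply: disj; exists x; split=> //; exact: UW.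
apply: sub_meager (meagerU (meager_setD_second_category A scX)
                           (nowhere_dense_meager ndU)).
by move=> x [Ux Ax]; have [dAx|ndAx] := pselect (d A x); [right|left].
Qed.

Definition baire := forall U, open U -> meager U -> U = set0.

Hypothesis baireX : baire.

Lemma open_second_category U : open U -> d U = k U.
Proof.
move=> oU; apply/seteqP; split; first exact: second_category_sub_closure.
move=> p kp V pV mV; have [x [Ux Vx]] := kp _ (open_nbhs_nbhs pV).
have : (V `&` U) x by [].
by rewrite (baireX (openI pV.1 oU) mV).
Qed.

(** A closed set differs from its interior by its nowhere dense frontier. *)
Lemma closed_second_categoryE F : closed F -> d F = k (interior F).
Proof.
move=> cF; apply/seteqP; split; last first.
  rewrite -open_second_category; last exact: open_interior.
  by apply: sub_second_category; exact: interior_subset.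
move=> p dp W; rewrite nbhsE => -[U pU UW]; apply: contrapT => disj.
apply: dp (pU) _; apply: nowhere_dense_meager.
apply: closed_nowhere_dense; [by []|by case: pU|].
rewrite -subset0 => x [Ux iFx]; apply: disj; exists x; split=> //; exact: UW.
Qed.

End SecondCategory.

(** * Polish spaces *)

Section Polish.
Variables (R : realType) (X : topologicalType) (d : X -> X -> R).
Hypotheses (md : metric d) (topd : induces_topology d).
Local Open Scope ring_scope.

Local Notation ball x e := [set y | d x y < e].

Let dC x y : d x y = d y x. Proof. by case: md. Qed.
Let dT x y z : d x z <= d x y + d y z. Proof. by case: md. Qed.
Let dxx x : d x x = 0. Proof. by case: md => _ d0 _ _; apply/d0. Qed.

Lemma open_metric_ball x e : open (ball x e).
Proof.
rewrite openE => y /= xy; rewrite /interior topd; exists (e - d x y).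
  by rewrite /= subr_gt0.
by move=> z /= yz; apply: le_lt_trans (dT x y z) _; rewrite -ltrBrDl.
Qed.

Lemma open_metricP U x : open U -> U x -> exists2 e, 0 < e & ball x e `<=` U.
Proof. by move=> oU Ux; have := open_nbhs_nbhs (conj oU Ux); rewrite topd. Qed.

(** The balls of radius [1/(n+1)] around the points of a countable dense set form
a basis. *)
Lemma separable_second_countable : separable X -> @second_countable X.
Proof.
move=> [D cD dD].
exists ((fun qn : X * nat => ball qn.1 qn.2.+1%:R^-1) @` (D `*` setT)).
  apply: card_le_trans (card_image_le _ _) _.
  by apply: countableX => //; exact: countableP.
split=> [_ [qn _ <-]|x W]; first exact: open_metric_ball.
rewrite topd => -[e e0 eW].
have [n] := @ltr_add_invr R 0 (e / 2) (divr_gt0 e0 (ltr0Sn _ 1)).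
rewrite add0r => ne.
have [|q [xq Dq]] := dD _ _ (open_metric_ball x n.+1%:R^-1).
  by exists x => /=; rewrite dxx invr_gt0.
exists (ball q n.+1%:R^-1).
  by split; [exists (q, n) | rewrite /= dC].
move=> y /= qy; apply: eW => /=; have := dT x q y; move: ne xq qy => /=.
by move: (n.+1%:R^-1) => r; lra.
Qed.

(** The Baire category theorem, by the usual nested balls.  The centre of
each ball is within half a radius of the previous centre, and its radius is at most
a quarter of the previous one, so that the limit of the centres lies in every open
ball. *)
Lemma complete_baire : complete_metric d -> baire X.
Proof.
move=> cd W oW [F nF WF]; rewrite -subset0 => x0 Wx0.
have [e0 e0_gt0 e0W] := open_metricP oW Wx0.
(* The bound on the radii makes the centres a Cauchy sequence. *)
pose P n (s s' : X * R) := [/\ 0 < s'.2, s'.2 <= n.+1%:R^-1, s'.2 <= s.2 / 4,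
  d s.1 s'.1 < s.2 / 2 & ball s'.1 s'.2 `&` F n = set0].
have /choice[f fP] (ns : nat * (X * R)) :
    exists s', 0 < ns.2.2 -> P ns.1 ns.2 s'.
  case: ns => n [x r] /=; have [r0|?] := pselect (0 < r); last by exists (x, r).
  have [y [xy ncly]] : ball x (r / 2) `\` closure (F n) !=set0.
    apply/set0P/eqP; rewrite setD_eq0 => sub; suff: (set0 : set X) x by [].
    by rewrite -(nF n) /interior topd; exists (r / 2) => //=; exact: divr_gt0.
  have [|e e1 eF] := @open_metricP (~` closure (F n)) y _ ncly.
    by rewrite openC; exact: closed_closure.
  exists (y, Num.min e (Num.min n.+1%:R^-1 (r / 4))) => _.
  split=> //=.
  - by rewrite !lt_min e1 invr_gt0 ltr0Sn divr_gt0.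
  - by rewrite !ge_min lexx !orbT.
  - by rewrite !ge_min lexx !orbT.
  - rewrite -subset0 => z [/=]; rewrite lt_min => /andP[yz _] Fz.
    exact: (eF z yz) (subset_closure Fz).
have [u [u0 uS]] : exists u, u 0%N = (x0, e0) /\ forall n, u n.+1 = f (n, u n).
  by exists (fix u n := if n is m.+1 then f (m, u m) else (x0, e0)).
have u_gt0 n : 0 < (u n).2.
  elim: n => [|n IH]; first by rewrite u0.
  by rewrite uS; have [] := fP (n, u n) IH.
have uP n : P n (u n) (u n.+1) by rewrite uS; exact: fP (n, u n) (u_gt0 n).
have nested n m : (n <= m)%N -> ball (u m).1 (u m).2 `<=` ball (u n).1 (u n).2.
  elim: m => [|m IH]; first by rewrite leqn0 => /eqP->.
  rewrite leq_eqVlt => /predU1P[->//|/IH]; apply: subset_trans => y /= uy.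
  have [_ _ r2 d2 _] := uP m; have := dT (u m).1 (u m.+1).1 y; have := u_gt0 m; lra.
have near n m : (n <= m)%N -> d (u n).1 (u m).1 < (u n).2.
  by move=> /nested; apply => /=; rewrite dxx.
have [|l ul] := cd (fun n => (u n).1).
  move=> e e_gt0; have [n] := @ltr_add_invr R 0 (e / 2) (divr_gt0 e_gt0 (ltr0Sn _ 1)).
  rewrite add0r => ne; exists n.+1 => i j /near iN /near jN.
  have small : (u n.+1).2 < e / 2 by have [_ ? _ _ _] := uP n; exact: le_lt_trans ne.
  have := dT (u i).1 (u n.+1).1 (u j).1; rewrite /= (dC (u i).1 (u n.+1).1); lra.
have lu n : d (u n).1 l < (u n).2.
  have [r1 _ r2 d2 _] := uP n.
  have /ul[N _ Nl] : nbhs l (ball l (u n.+1).2) by rewrite topd; exists (u n.+1).2.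
  have /= lN := Nl _ (leq_maxl N n.+1).
  have /= Nn := near n.+1 _ (leq_maxr N n.+1).
  have := dT (u n).1 (u n.+1).1 l; have := dT (u n.+1).1 (u (maxn N n.+1)).1 l.
  by move: r2 d2 lN Nn; rewrite (dC l); lra.
have : W l by apply: e0W; have := lu 0%N; rewrite u0.
rewrite WF => -[n _ Fnl]; have [_ _ _ _] := uP n; rewrite -subset0.
by move=> /(_ l); apply; split => //; exact: lu.
Qed.

End Polish.

(** * The twenty-two reduced words *)

Inductive letter := K | C | D.

Lemma letter_eq_dec (a b : letter) : {a = b} + {a <> b}.
Proof. decide equality. Defined.

HB.instance Definition _ := hasDecEq.Build letter (compareP letter_eq_dec).

(** Words act on any type carrying a closure, a complement and a localization;
besides sets, these will be the states of the finite models below. *)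
Definition act (T : Type) (f : letter -> T -> T) (w : seq letter) (x : T) :=
  foldr f x w.

Definition kcd_op (X : topologicalType) (l : letter) : set X -> set X :=
  match l with
  | K => @closure X
  | C => @setC X
  | D => @second_category_points X
  end.

(** The words in [w10] are those with closed values; composing with [C] on the
left gives those with open values. *)
Definition reduced_words : seq (seq letter) :=
  let w5 := [:: [:: K]; [:: K; C; K]; [:: K; C; K; C; K]; [:: D]; [:: K; C; D]] in
  let w10 := w5 ++ [seq rcons w C | w <- w5] in
  [:: [::]; [:: C]] ++ w10 ++ [seq C :: w | w <- w10].

Definition mulK (w : seq letter) : seq letter :=
  match w with
  | K :: _ | D :: _ => w
  | C :: K :: C :: K :: C :: K :: v => K :: C :: K :: v
  | C :: K :: C :: D :: v => D :: v
  | _ => K :: w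
  end.

(** If [w] starts with [K] or [D], its value is a closed set, on which [D] is
the closure of the interior, and the value of [C :: w] is an open set, on which
[D] is the closure. *)
Definition mul (l : letter) (w : seq letter) : seq letter :=
  match l, w with
  | K, _ => mulK w
  | C, C :: v => v
  | D, D :: _ => w
  | D, K :: _ => mulK (C :: mulK (C :: w))
  | D, C :: K :: _ | D, C :: D :: _ => mulK w
  | _, _ => l :: w
  end.

(** A finite check over the 66 products. *)
Lemma reduced_wordsM l w :
  w \in reduced_words -> mul l w \in reduced_words.
Proof.
have: all (fun v => [&& mul K v \in reduced_words, mul C v \in reduced_words
                     & mul D v \in reduced_words]) reduced_words by [].
by move=> /allP/[apply]/and3P[]; case: l.
Qed.

Section Words.
Variable X : topologicalType.
Hypotheses (scX : @second_countable X) (baireX : baire X).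
Implicit Types (A F : set X) (w : seq letter).

Local Notation d := (@second_category_points X).
Local Notation k := (@closure X).
Local Notation "w '$' A" := (act (@kcd_op X) w A) (at level 40).

Let closureK A : k (k A) = k A.
Proof. by rewrite -((closure_id _).1 (@closed_closure _ A)). Qed.

Let closure_second_category A : k (d A) = d A.
Proof. by rewrite -((closure_id _).1 (@closed_second_category _ A)). Qed.

Let interiorE A : interior A = ~` k (~` A).
Proof. by rewrite -interiorC setCK. Qed.

(** For the open set [O = ~` k A] and with [i] for the interior, this is
[k (i (k O)) = k O]: the set [k O] is closed and contains its interior, and [O] is
contained in the interior of its closure. *)
Lemma kuratowski A : k (~` k (~` k (~` k A))) = k (~` k A).
Proof.
rewrite -!interiorE; apply/seteqP; split.
  rewrite -[X in _ `<=` X]closureK; apply: closureS.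
  exact: interior_subset.
apply: closureS.
have oA : open (~` k A) by rewrite openC; exact: closed_closure.
by rewrite -[X in X `<=` _](interior_id _).1//; apply: interiorS; exact: subset_closure.
Qed.

Lemma act_mulK w A : mulK w $ A = k (w $ A).
Proof.
case: w => [|[] w] //=; case: w => [|[] w] //=; case: w => [|[] w] //=; case: w => [|[] w] //=.
  case: w => [|[] w] //=; case: w => [|[] w] //=.
  by rewrite kuratowski.
by rewrite -interiorE interior_second_category.
Qed.

Arguments mulK : simpl never.

Lemma act_mul l w A : mul l w $ A = kcd_op l (w $ A).
Proof.
have dcl F : closed F -> d F = k (~` k (~` F)).
  by move=> cF; rewrite closed_second_categoryE// interiorE.
have dop F : closed F -> d (~` F) = k (~` F).
  by move=> cF; rewrite open_second_category// openC.
case: l; first exact: act_mulK.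
  by case: w => [|[] w] //=; rewrite setCK.
case: w => [|[] w] //=.
- by rewrite act_mulK /= act_mulK dcl //; exact: closed_closure.
- case: w => [|[] w] //; rewrite act_mulK /= dop //.
    exact: closed_closure.
  exact: closed_second_category.
- rewrite (dcl (d _)); last exact: closed_second_category.
  by rewrite -interiorE interior_second_category.
Qed.

Lemma KD_act w : KD X (act (@kcd_op X) w).
Proof.
move=> M [[M1 MM] Mgen]; elim: w => [|l w IH]; first exact: M1.
by apply: (MM (kcd_op l) (act (@kcd_op X) w)) IH; apply: Mgen; case: l; [left; left|left; right|right].
Qed.

(** The operators [o] such that [o \o w] is given by a reduced word whenever
[w] is a reduced word form a submonoid, which contains the generators; the empty
word is one of these [w]. *)
Lemma KD_reduced : KD X = act (@kcd_op X) @` [set` reduced_words].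
Proof.
apply/seteqP; split=> [o KDo|_ [w _ <-]]; last exact: KD_act.
pose M := [set o : set X -> set X | forall w, w \in reduced_words ->
  exists2 v, v \in reduced_words & forall A, v $ A = o (w $ A)].
have [] := KDo M _ [::] isT; last first.
  by move=> v vr vo; exists v => //; apply/funext => A; rewrite vo.
split; first split.
- by move=> w wr; exists w.
- move=> o1 o2 M1 M2 w /M2[v /M1[u ur uo] vo].
  by exists u => // A; rewrite uo vo.
have Ml l : M (@kcd_op X l).
  by move=> w wr; exists (mul l w); [exact: reduced_wordsM | exact: act_mul].
by move=> _ [[]|] ->; [exact: Ml K|exact: Ml C|exact: Ml D].
Qed.

End Words.

Definition reduced_word (n : nat) := nth [::] reduced_words n.

Lemma image_reduced_word : reduced_word @` `I_22 = [set` reduced_words].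
Proof.
apply/seteqP; split=> [_ [n /= n22 <-]|w /= wr]; first exact: mem_nth.
exists (index w reduced_words); last exact: nth_index.
by move: wr; rewrite -index_mem.
Qed.

(** * Locality *)

Definition local_op (X : topologicalType) (o : set X -> set X) :=
  forall U A B, open U -> U `&` A = U `&` B -> U `&` o A = U `&` o B.

Section Locality.
Variable X : topologicalType.
Implicit Types (U A B : set X).

Lemma sub_local_op (o : set X -> set X) :
  (forall U A B, open U -> U `&` A = U `&` B -> U `&` o A `<=` o B) ->
  local_op o.
Proof.
move=> H U A B oU UAB; apply/seteqP; split=> x [Ux ox]; split=> //.
  exact: (H U A B).
exact: (H U B A).
Qed.

Lemma local_act w : local_op (act (@kcd_op X) w).
Proof.
elim: w => [|l w IH] U A B oU UAB //=.
have {IH} := IH U A B oU UAB; move: (act _ w A) (act _ w B) => {}A {}B {}UAB.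
suff: local_op (@kcd_op X l) by apply.
case: l {A B UAB U oU} => /=.
- apply: sub_local_op => U A B oU UAB x [Ux kx] W Wx.
  have [|y [Ay [Uy Wy]]] := kx (U `&` W).
    by apply: filterI => //; exact: open_nbhs_nbhs.
  by exists y; split=> //; have [] : (U `&` B) y by rewrite -UAB.
- apply: sub_local_op => U A B oU UAB x [Ux /= nA] Bx; apply: nA.
  by have [] : (U `&` A) x by rewrite UAB.
- apply: sub_local_op => U A B oU UAB x [Ux dx] W [oW Wx] mWB.
  apply: dx (conj (openI oU oW) (conj Ux Wx)) _.
  apply: sub_meager mWB => y [[Uy Wy] Ay].
  by split=> //; have [] : (U `&` B) y by rewrite -UAB.
Qed.

(** If the operators act on the sets [phi t] through the parameter [t], then words
can be evaluated on the parameters. *)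
Lemma act_morph (T : Type) (f : letter -> T -> T) (phi : T -> set X) :
  (forall l t, kcd_op l (phi t) = phi (f l t)) ->
  forall w t, act (@kcd_op X) w (phi t) = phi (act f w t).
Proof. by move=> fphi; elim=> //= l w IH t; rewrite IH fphi. Qed.

End Locality.

(** * The real line as a Baire space *)

Section RealLine.
Variable R : realType.
Local Open Scope ring_scope.

Lemma polish_real : polish R R.
Proof.
split.
  exists (range ratr); last exact: dense_rat.
  by apply: card_le_trans (card_image_le _ _) _; exact: countableP.
exists (fun x y => `|x - y|); split.
- split=> [x y|x y|x y|x y z].
  + exact: normr_ge0.
  + by split=> [/eqP|->]; rewrite ?subrr ?normr0// normr_eq0 subr_eq0 => /eqP.
  + exact: distrC.
  + exact: ler_distD.
- by move=> x; rewrite -nbhs_ballE.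
- move=> u cu; apply/cvg_ex/cauchy_cvgP/cauchy_ballP => e e0.
  have [N uN] := cu e e0.
  pose tail := u @` [set n | (N <= n)%N].
  exists (tail, tail); first by split; exists N => // n Nn; exists n.
  by move=> [_ _] /= [[m Nm <-] [n Nn <-]]; exact: uN.
Qed.

Lemma second_countable_real : @second_countable R.
Proof.
have [sR [dist [md td _]]] := polish_real.
exact: separable_second_countable md td sR.
Qed.

Lemma baire_real : baire R.
Proof. have [_ [dist [md td cd]]] := polish_real; exact: complete_baire md td cd. Qed.

End RealLine.

(** * A set everywhere of second category together with its complement *)

Lemma nowhere_dense_preimage (X Y : topologicalType) (f : X -> Y) (g : Y -> X) A :
  continuous f -> continuous g -> cancel f g -> cancel g f ->
  nowhere_dense A -> nowhere_dense (f @^-1` A).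
Proof.
move=> cf cg fK gK ndA; rewrite /nowhere_dense -subset0 => x ix.
suff : (set0 : set Y) (f x) by [].
have sub : closure (f @^-1` A) `<=` f @^-1` closure A.
  by move=> z kz W /(cf z)/kz[y [Ay Wy]]; exists (f y).
have gx : nbhs (f x) (g @^-1` closure (f @^-1` A)) by apply: cg; rewrite fK.
rewrite -ndA /interior.
by apply: filterS gx => y /sub /=; rewrite gK.
Qed.

Lemma meager_preimage (X Y : topologicalType) (f : X -> Y) (g : Y -> X) A :
  continuous f -> continuous g -> cancel f g -> cancel g f ->
  meager A -> meager (f @^-1` A).
Proof.
move=> cf cg fK gK [F nF ->]; exists (fun n => f @^-1` F n).
  by move=> n; exact: nowhere_dense_preimage (nF n).
exact: preimage_bigcup.
Qed.

Section Triadic.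
Variable R : realType.
Local Open Scope ring_scope.
Local Notation d := (@second_category_points R).
Implicit Types (x y p g t : R) (A B : set R).

Lemma meager_translate t A : meager A -> meager [set x | A (x + t)].
Proof.
apply: (@meager_preimage _ _ (fun x => x + t) (fun x => x - t) A).
- by move=> x; apply: cvgD; [exact: cvg_id | exact: cvg_cst].
- by move=> x; apply: cvgB; [exact: cvg_id | exact: cvg_cst].
- exact: addrK.
- exact: subrK.
Qed.

Definition triadic : set R := [set x | exists n, 3 ^+ n * x \is a Num.int].

Lemma triadicN x : triadic x -> triadic (- x).
Proof. by move=> [n xn]; exists n; rewrite mulrN rpredN. Qed.

Lemma triadicD x y : triadic x -> triadic y -> triadic (x + y).
Proof.
move=> [m xm] [n yn]; exists (m + n)%N.
rewrite mulrDr {1}addnC !exprD -!mulrA.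
by apply: rpredD; apply: rpredM => //; apply: rpredX; apply: rpred_nat.
Qed.

Lemma triadicB x y : triadic x -> triadic y -> triadic (x - y).
Proof. by move=> tx ty; apply/triadicD/triadicN. Qed.

Lemma triadic_nat n : triadic n%:R.
Proof. by exists 0%N; rewrite mul1r rpred_nat. Qed.

(** Powers of 3 are odd. *)
Lemma half_not_triadic : ~ triadic 2^-1.
Proof.
move=> [n /intrP[m]] /(congr1 (fun z => z * 2)); rewrite divfK ?pnatr_eq0 //.
rewrite -natrX -[2]/(2%:~R) -intrM -[_%:R]/(Posz _)%:~R => /eqP.
rewrite eqr_int => /eqP/(congr1 (fun z : int => odd `|z|%N)).
by rewrite abszM /= oddX oddM andbF orbT.
Qed.

(** With numerator [m] over [3 ^ n], one of [m] and [m - 3 ^ n] is even. *)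
Lemma triadic_half x : triadic x -> triadic (x / 2) \/ triadic ((x - 1) / 2).
Proof.
have half (m : int) : ~~ odd `|m|%N -> m%:~R / 2 \is a @Num.int R.
  move=> em; have [q ->] : exists q : int, m = q * 2 by exists (m %/ 2)%Z; lia.
  by rewrite intrM mulfK ?pnatr_eq0 // rpred_int.
move=> [n /intrP[m xm]]; have [om|em] := boolP (odd `|m|%N); [right|left].
  exists n; rewrite mulrA mulrBr xm mulr1 -natrX -[_%:R]/(Posz _)%:~R -intrB.
  have : odd (3 ^ n) by rewrite oddX orbT.
  by move: (3 ^ n)%N => q oq; apply: half; lia.
by exists n; rewrite mulrA xm; exact: half.
Qed.

(** The doubles of triadic numbers are dense. *)
Lemma triadic_approx x (e : R) : 0 < e -> exists g, triadic (g / 2) /\ `|x - g| < e.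
Proof.
move=> e0; pose n := Num.bound (2 / e).
have n2 : 2 / e < 3 ^+ n.
  apply: lt_le_trans (upper_nthrootP (leqnn n)) _.
  by apply: lerXn2r; rewrite ?nnegrE ?ler_nat.
have [q0 q_neq0] : 0 < 3 ^+ n :> R /\ 3 ^+ n != 0 :> R.
  by rewrite gt_eqF exprn_gt0.
have [q qE] : exists q : R, q = 3 ^+ n by exists (3 ^+ n).
rewrite -qE in n2 q0 q_neq0.
have [a ai /andP[a1 a2]] : exists2 a : R, a \is a Num.int & a <= q * x / 2 < a + 1.
  exists (Num.floor (q * x / 2))%:~R; first exact: rpred_int.
  by rewrite ge_floor -[X in _ + X]/(1%:~R) -intrD lt_succ_floor.
have ge : q * (2 * a / q / 2) = a by field.
exists (2 * a / q); split; first by exists n; rewrite -qE ge.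
have xE : x - 2 * a / q = 2 / q * (q * x / 2 - a) by field.
rewrite xE ger0_norm; last by rewrite mulr_ge0 ?divr_ge0 ?subr_ge0 // ltW.
apply: (@le_lt_trans _ _ (2 / q)).
  by rewrite ler_piMr ?divr_ge0 ?ltW // ltrBlDr addrC.
by rewrite ltr_pdivrMr // mulrC -ltr_pdivrMr.
Qed.

Lemma nowhere_dense1 x : nowhere_dense [set x].
Proof.
have c1 : closed [set x] by exact: closed_eq.
rewrite /nowhere_dense -((closure_id _).1 c1) -subset0 => y iy.
have [z [/interior_subset zx []]] :=
  @dense_set1C R x _ (ex_intro _ y iy) (@open_interior _ [set x]).
exact: zx.
Qed.

Lemma meager_triadic : meager triadic.
Proof.
have -> : triadic = \bigcup_(nm in [set: nat * int]) [set nm.2%:~R / 3 ^+ nm.1].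
  apply/seteqP; split=> [x [n /intrP[m xm]]|_ [[n m] _ ->]].
    by exists (n, m) => //=; rewrite -xm mulrC mulKf // expf_eq0 pnatr_eq0 andbF.
  by exists n; rewrite /= mulrC divfK ?rpred_int // expf_eq0 pnatr_eq0 andbF.
apply: meager_bigcup => [|nm _]; first exact: countableP.
exact/nowhere_dense_meager/nowhere_dense1.
Qed.

(** The chosen element depends only on the set it is chosen from, that is, on the
coset of [x]. *)
Definition coset_rep x : R := xget 0 [set y | triadic (x - y)].

Lemma triadic_coset_rep x : triadic (x - coset_rep x).
Proof.
rewrite /coset_rep; case: xgetP => [y _ //|/(_ x)].
by rewrite /= subrr; case; exact: (triadic_nat 0).
Qed.

Lemma coset_repD x t : triadic t -> coset_rep (x + t) = coset_rep x.
Proof.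
move=> tt; congr (xget _ _); apply/seteqP; split=> y /= ty.
  by rewrite (_ : x - y = x + t - y - t); [exact: triadicB | ring].
by rewrite (_ : x + t - y = x - y + t); [exact: triadicD | ring].
Qed.

(** The union of [r + 2T] over the representatives [r] of the cosets of the group
[T] of triadic numbers. *)
Definition half_vitali : set R := [set x | triadic ((x - coset_rep x) / 2)].

Lemma half_vitaliD x g : triadic (g / 2) -> half_vitali (x + g) <-> half_vitali x.
Proof.
move=> tg; have tg2 : triadic g by rewrite (splitr g); exact: triadicD.
rewrite /half_vitali /= coset_repD //; split=> tx.
  rewrite (_ : _ / 2 = (x + g - coset_rep x) / 2 - g / 2); last by field.
  exact: triadicB.
rewrite (_ : _ / 2 = (x - coset_rep x) / 2 + g / 2); last by field.
exact: triadicD.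
Qed.

Lemma half_vitali1 x : half_vitali (x + 1) <-> ~ half_vitali x.
Proof.
have t1 := triadic_nat 1.
rewrite /half_vitali /= coset_repD //; set u := x - coset_rep x.
rewrite (_ : x + 1 - coset_rep x = u + 1); last by rewrite /u; ring.
split=> [tu1 tu|ntu].
  apply: half_not_triadic; rewrite (_ : 2^-1 = (u + 1) / 2 - u / 2); last by field.
  exact: triadicB.
have [//|tu] := triadic_half (triadic_coset_rep x).
rewrite -/u in tu; rewrite (_ : _ / 2 = (u - 1) / 2 + 1); last by field.
exact: triadicD.
Qed.

(** One point of [d A] can be moved into any open set by some translation [g + c],
since the [g] are dense, and each of these translations maps [A] into [B]. *)
Lemma second_category_translates A B c p : d A p ->
  (forall g, triadic (g / 2) -> forall x, A x -> B (x + (g + c))) -> d B = setT.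
Proof.
move=> dAp AB; apply/seteqP; split=> // x _ U [oU Ux] mUB.
have [e e0 eU] : exists2 e : R, 0 < e & [set y | `|x - y| < e] `<=` U.
  have := open_nbhs_nbhs (conj oU Ux); rewrite -nbhs_ballE => -[e e0 eU].
  by exists e.
have [g [tg xg]] := triadic_approx (x - p - c) e0.
have /dAp : open_nbhs p [set y | U (y + (g + c))].
  split; last first.
    by apply: eU; rewrite /= (_ : x - _ = x - p - c - g) //; ring.
  apply: (@open_comp _ _ (fun y => y + (g + c))) => // y _.
  by apply: cvgD; [exact: cvg_id | exact: cvg_cst].
apply; apply: sub_meager (meager_translate (g + c) mUB) => y [/= Uy Ay].
by split=> //; exact: AB.
Qed.

(** The line is the union of the set and one translate of it, so by the Baire
category theorem the set is not meager; translations then spread a single point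
of second category over the line. *)
Lemma second_category_half_vitali :
  d half_vitali = setT /\ d (~` half_vitali) = setT.
Proof.
have [p dp] : exists p, d half_vitali p.
  apply: contrapT => /forallNP nd.
  have mV : meager half_vitali.
    apply: sub_meager (meager_setD_second_category half_vitali (second_countable_real R)).
    by move=> x Vx; split=> //; exact: nd.
  have : [set: R] = set0.
    apply: baire_real; first exact: openT.
    apply: sub_meager (meagerU mV (meager_translate 1 mV)) => x _.
    by have [Vx|/half_vitali1 V1] := pselect (half_vitali x); [left|right].
  by move/seteqP => [+ _] => /(_ 0 I).
split.
  apply: (second_category_translates (c := 0) dp) => g tg x.
  by rewrite addr0 half_vitaliD.
apply: (second_category_translates (c := 1) dp) => g tg x Vx.
by rewrite addrA /= half_vitali1 => /(_ ((half_vitaliD _ tg).2 Vx)).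
Qed.

End Triadic.

(** * Two finite models *)

(** The truth values of a set on the three parts of the line which [cut] and
[mix] below distinguish. *)
Definition state := (bool * bool * bool)%type.

(** The middle part is a point: it is meager and lies in the closure of both
half-lines. *)
Definition cut_op (l : letter) (s : state) : state :=
  let: (a, b, c) := s in
  match l with
  | K => (a, [|| a, b | c], c)
  | C => (~~ a, ~~ b, ~~ c)
  | D => (a, a || c, c)
  end.

(** All three parts are dense, and the middle one is meager, while the others are
everywhere of second category. *)
Definition mix_op (l : letter) (s : state) : state :=
  let: (a, b, c) := s in
  match l with
  | K => let e := [|| a, b | c] in (e, e, e)
  | C => (~~ a, ~~ b, ~~ c)
  | D => let e := a || c in (e, e, e)
  end.

Section Models.
Variable R : realType.
Local Open Scope ring_scope.
Local Notation d := (@second_category_points R).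
Local Notation k := (@closure R).

Definition cut (p : R) (s : state) : set R :=
  [set x | if x < p then s.1.1 else if x == p then s.1.2 else s.2].

Definition mix (s : state) : set R :=
  [set x | if `[< triadic x >] then s.1.2
           else if `[< half_vitali x >] then s.1.1 else s.2].

Lemma closure_cut p s : k (cut p s) = cut p (cut_op K s).
Proof.
have kif (b : bool) (A : set R) : k [set x | b /\ A x] = [set x | b /\ k A x].
  case: b.
    rewrite (_ : [set x | _ /\ A x] = A); last by apply/seteqP; split=> x // [].
    by apply/seteqP; split=> x // [].
  rewrite (_ : [set x | _ /\ A x] = set0); last by apply/seteqP; split=> x // [].
  by rewrite closure0; apply/seteqP; split=> x // [].
have c1 : closed [set x | x == p].
  by rewrite (_ : [set x | x == p] = [set p]); [exact: closed_eq|apply/seteqP; split=> x /eqP].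
case: s => [[a b] c].
have -> : cut p (a, b, c) = [set x | a /\ [set y | y < p] x] `|`
    [set x | b /\ [set y | y == p] x] `|` [set x | c /\ [set y | p < y] x].
  apply/seteqP; split=> x; rewrite /cut /=; case: ltgtP; intuition (discriminate || auto).
rewrite !closureU !kif closure_lt closure_gt -((closure_id _).1 c1).
apply/seteqP; split=> x; rewrite /cut /=; case: ltgtP;
  case: a b c => [] [] []; intuition (discriminate || auto).
Qed.

Lemma setC_cut p s : ~` cut p s = cut p (cut_op C s).
Proof.
case: s => [[a b] c]; apply/seteqP; split=> x; rewrite /cut /=.
  by case: ltgtP => _ /negP.
by case: ltgtP => _ /negP.
Qed.

Lemma open_cut p a c : open (cut p (a, false, c)).
Proof.
have -> : cut p (a, false, c) = ~` cut p (~~ a, true, ~~ c).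
  by rewrite setC_cut /= !negbK.
rewrite openC closure_id closure_cut /=; congr (cut p (_, _, _)).
by case: a; case: c.
Qed.

Lemma cut_opE l p s : kcd_op l (cut p s) = cut p (cut_op l s).
Proof.
case: l; case: s => [[a b] c]; first exact: closure_cut.
  exact: setC_cut.
(* Removing the point [p] changes the set by a meager set and makes it open. *)
transitivity (d (cut p (a, false, c))); last first.
  by rewrite (open_second_category (@baire_real R) (@open_cut p a c)) closure_cut.
apply/seteqP; split.
  apply: (sub_meager_second_category (nowhere_dense_meager (nowhere_dense1 p))).
  move=> x; rewrite /cut /=; case: ltgtP; [by left|by left|by right].
apply: sub_second_category => x; rewrite /cut /=.
by case: ltgtP.
Qed.

Lemma mix_opE l s : kcd_op l (mix s) = mix (mix_op l s).
Proof.
have mT := @meager_triadic R.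
have const (e : bool) (A : set R) : A = (if e then setT else set0) -> A = mix (e, e, e).
  by move=> ->; apply/seteqP; split=> x; rewrite /mix /=; case: e; do 2?case: ifP.
have [dV dnV] := second_category_half_vitali R.
have thick A B : d A = setT -> A `<=` B `|` @triadic R -> d B = setT.
  move=> dA AB; apply/seteqP; split=> // x _.
  by apply: (sub_meager_second_category mT AB); rewrite dA.
have inl b c : d (mix (true, b, c)) = setT.
  apply: (thick _ _ dV) => x Vx; rewrite /mix /=.
  by have [tx|ntx] := pselect (triadic x); [right|left; rewrite asboolF// asboolT].
have inr a b : d (mix (a, b, true)) = setT.
  apply: (thick _ _ dnV) => x Vx; rewrite /mix /=.
  by have [tx|ntx] := pselect (triadic x); [right|left; rewrite !asboolF].
have dense A : d A = setT -> k A = setT.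
  by move=> dA; apply/seteqP; split=> // x _; apply: second_category_sub_closure; rewrite dA.
case: s => [[a b] c]; case: l => /=.
- apply: const; case: a; first by rewrite dense ?inl.
  case: c; first by rewrite orbT dense ?inr.
  rewrite orbF; case: b; last first.
    by rewrite (_ : mix _ = set0) ?closure0 // -subset0 => x; rewrite /mix /=; do 2?case: ifP.
  apply/seteqP; split => // x _ W; rewrite -nbhs_ballE => -[e e0 eW].
  have [g [tg xg]] := triadic_approx x e0; exists g; split; last exact: eW.
  by rewrite /mix /= asboolT // (splitr g); exact: triadicD.
- by apply/seteqP; split=> x; rewrite /mix /=; do 2?case: ifP => _; move/negP.
- apply: const; case: a; first by rewrite inl.
  case: c; first by rewrite inr.
  apply: meager_second_category; apply: sub_meager mT => x.
  by rewrite /mix /=; case: ifP => [/asboolP//|_]; case: ifP.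
Qed.

End Models.

(** * Twenty-two different sets *)

(** The pieces of the extremal set, one around each of the integers 0 to 6: an
isolated point, a missing point, an open half-line at its end, the whole line,
the triadic points, their complement, and the points of [half_vitali] that are not
triadic.  The whole line separates the words with an even number of [C] from
those with an odd number; the other pieces separate the words of either kind from
each other.  The boolean is true for the model [cut] and false for [mix]. *)
Definition pieces : seq (bool * state) :=
  [:: (true, (false, true, false)); (true, (true, false, true));
      (true, (false, false, true)); (true, (true, true, true));
      (false, (false, true, false)); (false, (true, false, true));
      (false, (true, false, false))].

Definition piece_op (m : bool) := if m then cut_op else mix_op.

(** The truth values at the integers 0 to 6 of the set that a word makes of the
extremal set.  In both models an integer at the centre of its piece belongs to the
middle part. *)
Definition signature (w : seq letter) : seq bool :=
  [seq (act (piece_op p.1) w p.2).1.2 | p <- pieces].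

Lemma uniq_signature : uniq [seq signature w | w <- reduced_words].
Proof. by []. Qed.

Section Extremal.
Variable R : realType.
Local Open Scope ring_scope.

Definition piece (i : nat) : set R :=
  let p := nth (true, (false, false, false)) pieces i in
  (if p.1 then cut i%:R else @mix R) p.2.

Definition extremal_set : set R :=
  [set x | exists2 i, `|i%:R - x| < 2^-1 & piece i x].

(** Balls of radius 1/2 around different integers are disjoint. *)
Lemma extremal_setI i :
  [set x | `|i%:R - x| < 2^-1] `&` extremal_set =
  [set x | `|i%:R - x| < 2^-1] `&` piece i.
Proof.
apply/seteqP; split=> x [/= ix]; last by split=> //; exists i.
move=> [j jx pj]; split=> //; suff -> : i = j by [].
have : `|i%:R - j%:R : R| < 1.
  have := ler_distD x i%:R j%:R; rewrite (distrC x); lra.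
rewrite -[i%:R]/((Posz i)%:~R) -[j%:R]/((Posz j)%:~R) -intrB -intr_norm.
rewrite -[1]/(1%:~R) ltr_int; lia.
Qed.

Lemma act_extremal_set w i : (i < 7)%N ->
  act (@kcd_op R) w extremal_set i%:R <-> nth false (signature w) i.
Proof.
move=> i7; pose U := [set x : R | `|i%:R - x| < 2^-1].
have Ui : U i%:R by rewrite /U /= subrr normr0 invr_gt0.
have oU : open U by exact: (ball_open (i%:R : R) 2^-1).
have UE := local_act w oU (extremal_setI i).
have -> : act (@kcd_op R) w extremal_set i%:R = act (@kcd_op R) w (piece i) i%:R.
  apply/propext; split=> ?.
    by have [] : (U `&` act (@kcd_op R) w (piece i)) i%:R by rewrite -UE.
  by have [] : (U `&` act (@kcd_op R) w extremal_set) i%:R by rewrite UE.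
rewrite (nth_map (true, (false, false, false))) // /piece.
case: (nth _ _ _) => [[] s] /=.
  by rewrite (act_morph (fun l => @cut_opE R l _)) /cut /= ltxx eqxx.
rewrite (act_morph (@mix_opE R)) /mix /= asboolT //; exact: triadic_nat.
Qed.

Lemma act_extremal_set_inj :
  {in `I_22 &, injective (fun n => act (@kcd_op R) (reduced_word n) extremal_set)}.
Proof.
move=> m n; rewrite !inE /= => m22 n22 eqA.
have eqs : signature (reduced_word m) = signature (reduced_word n).
  apply: (@eq_from_nth _ false) => [|i i7]; first by rewrite !size_map.
  rewrite size_map in i7.
  apply/idP/idP => /(act_extremal_set _ i7) ?; apply/(act_extremal_set _ i7).
    by rewrite -eqA.
  by rewrite eqA.
apply/eqP; rewrite -(nth_uniq [::] _ _ uniq_signature) //.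
by rewrite !(nth_map [::]) //; exact/eqP.
Qed.

End Extremal.

Theorem theorem1 (R : realType) :
  (forall X : topologicalType, polish R X -> KD X #<= `I_22) /\
  (exists A : set R, [set o A | o in KD R] #= `I_22).
Proof.
split=> [X [sX [dist [md td cd]]]|].
  rewrite KD_reduced; last first.
  - exact: complete_baire md td cd.
  - exact: separable_second_countable md td sX.
  rewrite -image_reduced_word.
  by apply: card_le_trans (card_image_le _ _) (card_image_le _ _).
exists (@extremal_set R).
rewrite KD_reduced; [|exact: second_countable_real|exact: baire_real].
rewrite -image_reduced_word !image_comp.
exact: inj_card_eq (@act_extremal_set_inj R).
Qed.
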